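(* Let $L$ be a Lie hyperalgebra over a hyperfield $F$. For every integer $n\geq 1$, the transitive closure $\mathcal{S}_n^*$ of the relation $\mathcal{S}_n$ on $L$ is a strongly regular relation on $L$.
   Context: **Hyperstructures.** $\mathscr{P}^*(H)$ is the set of non-empty subsets of $H$. A hyperoperation $\circ:H\times H\to\mathscr{P}^*(H)$ (and likewise any external map or hyperbracket with values in non-empty subsets) is extended to non-empty subsets by $A\circ B=\bigcup_{a\in A,b\in B}a\circ b$; elements are identified with singletons. $(H,\circ)$ is a semihypergroup if $\circ$ is associative, and a hypergroup if moreover $x\circ H=H\circ x=H$ for all $x\in H$. A hyperring $(R,+,\cdot)$: $(R,+)$ is a hypergroup, $(R,\cdot)$ a semihypergroup, and $\cdot$ is distributive over $+$. A hyperfield is a hyperring such that $(R,\cdot)$ (or $(R-\{0\},\cdot)$, if $R$ contains $0$) is a hypergroup. A hypervector space over a hyperfield $F$ is a hypergroup $(M,+)$ with a map $F\times M\to\mathscr{P}^*(M)$, $(a,x)\mapsto a\cdot x=ax$, such that $a(x+y)=ax+ay$, $(a+b)x=ax+bx$, $(ab)x=a(bx)$ for all $a,b\in F$, $x,y\in M$. Standing assumptions: every hypervector space $M$ has a scalar identity $0_M$ for $+$ (i.e. $0_M+x=x+0_M=\{x\}$), and every hyperfield $F$ has a scalar identity $0_F$ for $+$ and a multiplication unit $1$, such that $0_F x=\{0_M\}$ and $1x=\{x\}$ for all $x\in M$. **Lie hyperalgebras.** A Lie hyperalgebra over a hyperfield $F$ is a hypervector space $L$ over $F$ with a map (hyperbracket)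 $[-,-]:L\times L\to\mathscr{P}^*(L)$ that is bilinear, i.e. $[\lambda_1x_1+\lambda_2x_2,y]=\lambda_1[x_1,y]+\lambda_2[x_2,y]$ and $[x,\lambda_1y_1+\lambda_2y_2]=\lambda_1[x,y_1]+\lambda_2[x,y_2]$, such that $0\in[x,x]$ and $0\in[x,[y,z]]+[y,[z,x]]+[z,[x,y]]$ for all $x,y,z\in L$. Put $[A,B]=\bigcup_{a\in A,b\in B}[a,b]$, $L^{[0]}=L$, and $L^{[i]}=[L^{[i-1]},L^{[i-1]}]$ for $i\ge1$. **Hyperbracket functions.** A hyperbracket function $f(g_1,\dots,g_m)$ is an arbitrary composition of the arguments $g_1,\dots,g_m$ using only the hyperbracket (a bracket monomial, each argument used once; for $m=1$, $f(g)=g$), extended to subsets. **The relation $\mathcal{S}_n$.** $\mathbb{S}_t$ is the symmetric group on $\{1,\dots,t\}$. For $n\in\mathbb{N}$ ($n\ge1$) and $x,y\in L$, $x\,\mathcal{S}_n\,y$ if and only if there exist: $t\in\mathbb{N}$ and $\sigma\in\mathbb{S}_t$; for $1\le i\le t$, $m_i\in\mathbb{N}$, a hyperbracket function $f_i$ of $m_i$ arguments, elements $h_{i1},\dots,h_{im_i}\in L$, and $\sigma_i\in\mathbb{S}_{m_i}$ such that $\sigma_i(j)=j$ whenever $h_{ij}\notin L^{[n-1]}$; for $1\le j\le m_i$, $p_{ij}\in\mathbb{N}$ and $\sigma_{ij}\in\mathbb{S}_{p_{ij}}$; for $1\le k\le p_{ij}$, $q_{ijk}\in\mathbb{N}$,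 $\lambda_{ijk1},\dots,\lambda_{ijkq_{ijk}}\in F$ and $\sigma_{ijk}\in\mathbb{S}_{q_{ijk}}$; such that $$x\in\sum_{i=1}^t\ell_i,\quad \ell_i=f_i(g_{i1},\dots,g_{im_i}),\quad g_{ij}=\Big(\sum_{k=1}^{p_{ij}}\big(\prod_{r=1}^{q_{ijk}}\lambda_{ijkr}\big)\Big)\cdot h_{ij},$$ $$y\in\sum_{i=1}^t\ell'_i,\quad \ell'_i=f_{\sigma(i)}(g'_{i1},\dots,g'_{im_{\sigma(i)}}),\quad g'_{ij}=A_{\sigma(i)\sigma_{\sigma(i)}(j)}\cdot h_{\sigma(i)\sigma_{\sigma(i)}(j)}\ (1\le j\le m_{\sigma(i)}),$$ where $A_{ij}=\sum_{k=1}^{p_{ij}}B_{ij\sigma_{ij}(k)}$ and $B_{ijk}=\prod_{r=1}^{q_{ijk}}\lambda_{ijk\sigma_{ijk}(r)}$. (Sums and products are taken in the indicated order.) $\mathcal{S}_n$ is reflexive and symmetric; $\mathcal{S}_n^*$ is its transitive closure. **Strong regularity.** For an equivalence relation $\rho$ on $L$ and non-empty $A,B\subseteq L$, write $A\,\bar{\bar\rho}\,B$ if $a\,\rho\,b$ for all $a\in A,b\in B$. $\rho$ is strongly regular if $x\,\rho\,y$ implies, for all $a\in L$ and $\lambda\in F$: $a+x\,\bar{\bar\rho}\,a+y$, $x+a\,\bar{\bar\rho}\,y+a$, $\lambda\cdot x\,\bar{\bar\rho}\,\lambda\cdot y$, $[a,x]\,\bar{\bar\rho}\,[a,y]$ and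 $[x,a]\,\bar{\bar\rho}\,[y,a]$. *)

(* Defs.v *)
From Stdlib Require Import Relation_Definitions Relation_Operators.
From mathcomp Require Import all_boot all_fingroup.
From mathcomp Require Import boolp classical_sets.

Set Implicit Arguments.
Unset Strict Implicit.
Unset Printing Implicit Defensive.

Local Open Scope classical_set_scope.

Definition hlift (A B C : Type) (op : A -> B -> set C)
    (X : set A) (Y : set B) : set C :=
  \bigcup_(x in X) \bigcup_(y in Y) op x y.

(* Hyperstructures carried by a subset [D] of [T], so that the same notion
   serves for [R] and for [R - {0}]; hyperoperations are [T -> T -> set T],
   with non-emptiness of values required separately. *)
Definition is_semihypergroup (T : Type) (D : set T) (op : T -> T -> set T) :=
  (forall x y, D x -> D y -> op x y !=set0 /\ op x y `<=` D) /\
  (forall x y z, D x -> D y -> D z ->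
     hlift op (op x y) [set z] = hlift op [set x] (op y z)).

Definition is_hypergroup (T : Type) (D : set T) (op : T -> T -> set T) :=
  is_semihypergroup D op /\
  (forall x, D x -> hlift op [set x] D = D /\ hlift op D [set x] = D).

Definition is_scalar_identity (T : Type) (op : T -> T -> set T) (e : T) :=
  forall x, op e x = [set x] /\ op x e = [set x].

(* A unit in the sense of hyperstructures; it need not be scalar. *)
Definition is_unit (T : Type) (op : T -> T -> set T) (e : T) :=
  forall x, op e x x /\ op x e x.

Definition is_distributive (T : Type) (mul add : T -> T -> set T) :=
  forall a b c,
    hlift mul [set a] (add b c) = hlift add (mul a b) (mul a c) /\
    hlift mul (add a b) [set c] = hlift add (mul a c) (mul b c).

Definition is_hyperring (T : Type) (add mul : T -> T -> set T) :=
  [/\ is_hypergroup setT add, is_semihypergroup setT mul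
    & is_distributive mul add].

Record hyperField := HyperField {
  hfsort :> Type;
  fadd : hfsort -> hfsort -> set hfsort;
  fmul : hfsort -> hfsort -> set hfsort;
  fzero : hfsort;
  fone : hfsort;
  fring : is_hyperring fadd fmul;
  fzeroP : is_scalar_identity fadd fzero;
  fmul_hypergroup : is_hypergroup [set~ fzero] fmul;
  foneP : is_unit fmul fone
}.

Record hyperVect (F : hyperField) := HyperVect {
  hvsort :> Type;
  vadd : hvsort -> hvsort -> set hvsort;
  vscale : F -> hvsort -> set hvsort;
  vzero : hvsort;
  vadd_hypergroup : is_hypergroup setT vadd;
  vzeroP : is_scalar_identity vadd vzero;
  vscale_neq0 : forall a x, vscale a x !=set0;
  vscaleDr : forall a x y,
    hlift vscale [set a] (vadd x y) = hlift vadd (vscale a x) (vscale a y);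
  vscaleDl : forall a b x,
    hlift vscale (fadd a b) [set x] = hlift vadd (vscale a x) (vscale b x);
  vscaleA : forall a b x,
    hlift vscale (fmul a b) [set x] = hlift vscale [set a] (vscale b x);
  vscale0 : forall x, vscale (fzero F) x = [set vzero];
  vscale1 : forall x, vscale (fone F) x = [set x]
}.

Arguments vadd {F} _ _ _.
Arguments vscale {F} _ _ _.
Arguments vzero {F} _.

Definition is_bilinear (F : hyperField) (V : hyperVect F)
    (br : V -> V -> set V) :=
  forall (a1 a2 : F) (x1 x2 y : V),
    hlift br (hlift (vadd V) (vscale V a1 x1) (vscale V a2 x2)) [set y] =
      hlift (vadd V) (hlift (vscale V) [set a1] (br x1 y))
                     (hlift (vscale V) [set a2] (br x2 y)) /\
    hlift br [set y] (hlift (vadd V) (vscale V a1 x1) (vscale V a2 x2)) =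
      hlift (vadd V) (hlift (vscale V) [set a1] (br y x1))
                     (hlift (vscale V) [set a2] (br y x2)).

Record lieHyperalgebra (F : hyperField) := LieHyperalgebra {
  lhsort :> hyperVect F;
  bracket : lhsort -> lhsort -> set lhsort;
  bracket_neq0 : forall x y, bracket x y !=set0;
  bracket_bilinear : is_bilinear bracket;
  bracket_alt : forall x, bracket x x (vzero lhsort);
  bracket_jacobi : forall x y z,
    hlift (vadd lhsort)
      (hlift (vadd lhsort)
         (hlift bracket [set x] (bracket y z))
         (hlift bracket [set y] (bracket z x)))
      (hlift bracket [set z] (bracket x y)) (vzero lhsort)
}.

Arguments bracket {F} _ _ _.

(* [hbig op F] is [F 0 o F 1 o ... o F n]: an ordered iteration of at least one
   term. No neutral element is involved, since [fone] need not be scalar. *)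
Fixpoint hbig (T : Type) (op : T -> T -> set T) (n : nat) :
    ('I_n.+1 -> set T) -> set T :=
  match n with
  | 0 => fun F => F ord0
  | n'.+1 => fun F => hlift op (F ord0) (hbig op (fun i => F (lift ord0 i)))
  end.

Inductive btree (I : Type) : Type :=
| BLeaf of I
| BNode of btree I & btree I.

Fixpoint bleaves (I : Type) (b : btree I) : seq I :=
  match b with
  | BLeaf i => [:: i]
  | BNode b1 b2 => bleaves b1 ++ bleaves b2
  end.

(* Bracket monomials in [m] arguments, each used exactly once, in any order.
   A tree has a leaf, so [m] is necessarily positive. *)
Record hbracket_fun (m : nat) := HBracketFun {
  hb_tree :> btree 'I_m;
  hb_once : perm_eq (bleaves hb_tree) (enum 'I_m)
}.

Section LieHyperalgebraTheory.

Variables (F : hyperField) (L : lieHyperalgebra F).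

Fixpoint Lder (i : nat) : set L :=
  if i is i'.+1 then hlift (bracket L) (Lder i') (Lder i') else setT.

Fixpoint beval (I : Type) (b : btree I) (g : I -> set L) : set L :=
  match b with
  | BLeaf i => g i
  | BNode b1 b2 => hlift (bracket L) (beval b1 g) (beval b2 g)
  end.

(* The positive integers t, p_ij, q_ijk of the mathematical definition are
   [t.+1], [(p i j).+1], [(q i j k).+1]; all indices start at 0. *)
Definition Srel (n : nat) (x y : L) : Prop :=
  exists (t : nat) (sigma : 'S_t.+1)
    (m : 'I_t.+1 -> nat)
    (f : forall i, hbracket_fun (m i))
    (h : forall i, 'I_(m i) -> L)
    (sigma1 : forall i, 'S_(m i))
    (p : forall i, 'I_(m i) -> nat)
    (sigma2 : forall i (j : 'I_(m i)), 'S_(p i j).+1)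
    (q : forall i (j : 'I_(m i)), 'I_(p i j).+1 -> nat)
    (lam : forall i (j : 'I_(m i)) (k : 'I_(p i j).+1), 'I_(q i j k).+1 -> F)
    (sigma3 : forall i (j : 'I_(m i)) (k : 'I_(p i j).+1), 'S_(q i j k).+1),
  let g i (j : 'I_(m i)) : set L :=
    hlift (vscale L)
      (hbig (@fadd F) (fun k : 'I_(p i j).+1 =>
         hbig (@fmul F) (fun r => [set lam i j k r])))
      [set h i j] in
  let B i (j : 'I_(m i)) (k : 'I_(p i j).+1) : set F :=
    hbig (@fmul F) (fun r => [set lam i j k (sigma3 i j k r)]) in
  let A i (j : 'I_(m i)) : set F :=
    hbig (@fadd F) (fun k => B i j (sigma2 i j k)) in
  let g' i (j : 'I_(m (sigma i))) : set L :=
    hlift (vscale L) (A (sigma i) (sigma1 (sigma i) j))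
      [set h (sigma i) (sigma1 (sigma i) j)] in
  [/\ forall i j, ~ Lder n.-1 (h i j) -> sigma1 i j = j,
      hbig (vadd L) (fun i => beval (f i) (g i)) x
    & hbig (vadd L) (fun i => beval (f (sigma i)) (g' i)) y].

Definition setrel (rho : L -> L -> Prop) (A B : set L) : Prop :=
  forall a b, A a -> B b -> rho a b.

Definition strongly_regular (rho : L -> L -> Prop) : Prop :=
  equivalence L rho /\
  forall x y, rho x y -> forall (a : L) (lambda : F),
    [/\ setrel rho (vadd L a x) (vadd L a y),
        setrel rho (vadd L x a) (vadd L y a),
        setrel rho (vscale L lambda x) (vscale L lambda y),
        setrel rho (bracket L a x) (bracket L a y)
      & setrel rho (bracket L x a) (bracket L y a)].

End LieHyperalgebraTheory.

(* Main.v *)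
Require Import Defs.
From Stdlib Require Import Relation_Definitions Relation_Operators.
From mathcomp Require Import all_boot all_fingroup.
From mathcomp Require Import boolp classical_sets.

(** Call a permutable sum the syntactic datum behind a pair [Srel n x y]: a
    list of bracket monomials whose arguments are sums of products of scalars
    times a vector, together with a permutation at each of the four levels.
    It has two values, the set where [x] lies, in which everything is read in
    the given order, and the set where [y] lies, in which everything is read
    through the permutations.

    Each translation [a + _], [_ + a], [lambda *: _], [[a, _]], [[_, a]] can
    be carried out on the datum itself, by an operation that covers the two
    values at once.  Adding [a] inserts a monomial [1 *: a] which the
    permutation of the monomials fixes.  Bracketing with [a] distributes over
    the sum and inserts into every monomial an argument [1 *: a] fixed by the
    permutation of the arguments, which the condition on moved arguments allows
    wherever [a] lies in the derived series.  Scaling distributes over the sum, is absorbed by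
    bilinearity into any one argument of a monomial, and distributes there over
    the coefficient, where it becomes a new first factor of each product.  Its
    two readings agree because the scaled argument is tied to its vector: in the
    permuted reading it sits wherever the permutation has put that vector.

    So [Srel n] itself is carried by translations into [Srel n]; its transitive
    closure inherits this because the values of the hyperoperations are not
    empty, which provides intermediate points.  Reversing the datum (all
    permutations are inverted) gives symmetry. *)

Set Implicit Arguments.
Unset Strict Implicit.
Unset Printing Implicit Defensive.

Local Open Scope classical_set_scope.

(** * Ordered iterations of a hyperoperation *)

Lemma hliftP (A B C : Type) (op : A -> B -> set C) X Y z :
  hlift op X Y z <-> exists x y, [/\ X x, Y y & op x y z].
Proof.
split=> [[x Xx [y Yy xyz]]|[x [y [Xx Yy xyz]]]]; first by exists x, y.
by exists x => //; exists y.
Qed.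

Lemma hlift_set1l (A B C : Type) (op : A -> B -> set C) a Y z :
  hlift op [set a] Y z <-> exists2 y, Y y & op a y z.
Proof.
rewrite hliftP; split=> [[x [y [-> Yy ayz]]]|[y Yy ayz]]; first by exists y.
by exists a, y.
Qed.

Lemma hlift_set1r (A B C : Type) (op : A -> B -> set C) X b z :
  hlift op X [set b] z <-> exists2 x, X x & op x b z.
Proof.
rewrite hliftP; split=> [[x [y [Xx -> xbz]]]|[x Xx xbz]]; first by exists x.
by exists x, b.
Qed.

Lemma hlift_set11 (A B C : Type) (op : A -> B -> set C) a b :
  hlift op [set a] [set b] = op a b.
Proof.
apply/seteqP; split=> z; first by case/hlift_set1l=> y ->.
by move=> abz; apply/hlift_set1l; exists b.
Qed.

Lemma hliftA (T : Type) (op : T -> T -> set T) :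
  is_semihypergroup setT op ->
  forall X Y Z, hlift op (hlift op X Y) Z = hlift op X (hlift op Y Z).
Proof.
move=> [_ opA] X Y Z; apply/seteqP; split=> w /hliftP.
- move=> [u [z [/hliftP[x [y [Xx Yy xyu]]] Zz uzw]]].
  have : hlift op (op x y) [set z] w by apply/hlift_set1r; exists u.
  rewrite opA // => /hlift_set1l[v yzv xvw]; apply/hliftP; exists x, v.
  by split=> //; apply/hliftP; exists y, z.
move=> [x [v [Xx /hliftP[y [z [Yy Zz yzv]]] xvw]]].
have : hlift op [set x] (op y z) w by apply/hlift_set1l; exists v.
rewrite -opA // => /hlift_set1r[u xyu uzw]; apply/hliftP; exists u, z.
by split=> //; apply/hliftP; exists x, y.
Qed.

Lemma hbig_recr (T : Type) (op : T -> T -> set T) :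
  is_semihypergroup setT op ->
  forall n (G : 'I_n.+2 -> set T),
  hbig op G = hlift op (hbig op (fun i : 'I_n.+1 => G (lift ord_max i)))
                       (G ord_max).
Proof.
move=> opS; elim=> [|n IHn] G.
  by rewrite /=; congr (hlift _ (G _) (G _)); apply: val_inj.
rewrite -[LHS]/(hlift op (G ord0) (hbig op (fun i => G (lift ord0 i)))).
rewrite IHn -hliftA //; congr (hlift op _ (G _)); last exact: val_inj.
rewrite -[RHS]/(hlift op (G (lift ord_max ord0))
  (hbig op (fun i : 'I_n.+1 => G (lift ord_max (lift ord0 i))))).
congr hlift; first by congr G; apply: val_inj.
congr hbig; apply/funext=> i; congr G; apply: val_inj.
by rewrite /= /bump /= !add1n ltnS addnS.
Qed.

(** Only an inclusion is claimed: it is all that membership of the translates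
    requires, and it makes the terms [H i] free to be any upper bounds. *)
Lemma hbig_distr (A B : Type) (opA : A -> A -> set A) (opB : B -> B -> set B)
    (f : A -> set B) :
  (forall x y z, opA x y z -> f z `<=` hlift opB (f x) (f y)) ->
  forall n (G : 'I_n.+1 -> set A) (H : 'I_n.+1 -> set B),
  (forall i x, G i x -> f x `<=` H i) ->
  forall x, hbig opA G x -> f x `<=` hbig opB H.
Proof.
move=> fD; elim=> [|n IHn] G H GH x /=; first exact: GH.
move=> /hliftP[u [v [Gu Gv uvx]]] z /(fD _ _ _ uvx)/hliftP[u' [v' [fu fv uvz]]].
apply/hliftP; exists u', v'; split=> //; first exact: GH fu.
exact: (IHn _ _ (fun i w => GH (lift ord0 i) w) v Gv).
Qed.

(** * Bracket monomials *)

Fixpoint bmap (I J : Type) (phi : I -> J) (b : btree I) : btree J :=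
  match b with
  | BLeaf i => BLeaf (phi i)
  | BNode b1 b2 => BNode (bmap phi b1) (bmap phi b2)
  end.

Lemma bleaves_bmap (I J : Type) (phi : I -> J) (b : btree I) :
  bleaves (bmap phi b) = map phi (bleaves b).
Proof. by elim: b => //= b1 -> b2 ->; rewrite map_cat. Qed.

Definition leaf_fun : hbracket_fun 1.
Proof.
by exists (BLeaf ord0); rewrite /= enum_ordSl (size0nil (size_enum_ord 0)).
Defined.

Lemma perm_eq_lift_bleaves m (f : hbracket_fun m) :
  perm_eq (ord0 :: bleaves (bmap (lift ord0) f)) (enum 'I_m.+1).
Proof.
by rewrite enum_ordSl perm_cons bleaves_bmap perm_map // (hb_once f).
Qed.

Definition bracketl_fun m (f : hbracket_fun m) : hbracket_fun m.+1 :=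
  @HBracketFun m.+1 (BNode (BLeaf ord0) (bmap (lift ord0) f))
    (perm_eq_lift_bleaves f).

Definition bracketr_fun m (f : hbracket_fun m) : hbracket_fun m.+1.
Proof.
exists (BNode (bmap (lift ord0) f) (BLeaf ord0)).
by rewrite /= perm_catC (perm_eq_lift_bleaves f).
Defined.

Lemma uniq_bleaves m (f : hbracket_fun m) : uniq (bleaves f).
Proof. by rewrite (perm_uniq (hb_once f)) enum_uniq. Qed.

Lemma mem_bleaves m (f : hbracket_fun m) j : j \in bleaves f.
Proof. by rewrite (perm_mem (hb_once f)) mem_enum. Qed.

(** Scaling a monomial needs some argument to absorb the scalar; the number of
    arguments is positive because a tree has a leaf. *)
Lemma hbracket_arg m (f : hbracket_fun m) : 'I_m.
Proof. by elim: (hb_tree f). Defined.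

Definition insert_at (X : Type) n (i0 : 'I_n.+1) (a : X) (G : 'I_n -> X)
  (i : 'I_n.+1) : X := oapp G a (unlift i0 i).

Lemma insert_at_id (X : Type) n (i0 : 'I_n.+1) (a : X) G :
  insert_at i0 a G i0 = a.
Proof. by rewrite /insert_at unlift_none. Qed.

Lemma insert_at_lift (X : Type) n (i0 : 'I_n.+1) (a : X) G i :
  insert_at i0 a G (lift i0 i) = G i.
Proof. by rewrite /insert_at liftK. Qed.

Section Translations.

Variables (F : hyperField) (L : lieHyperalgebra F).

(** * Bilinearity of the hyperbracket *)

Lemma vadd_semihypergroup : is_semihypergroup setT (vadd L).
Proof. by case: (vadd_hypergroup L). Qed.

Lemma vadd_neq0 x y : vadd L x y !=set0.
Proof. by case: vadd_semihypergroup => /(_ x y)[]. Qed.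

Lemma hlift_vadd0r (X : set L) : hlift (vadd L) X [set vzero L] = X.
Proof.
apply/seteqP; split=> z; rewrite hlift_set1r.
  by case=> x Xx; rewrite (vzeroP x).2 => ->.
by move=> Xz; exists z; rewrite ?(vzeroP z).2.
Qed.

Lemma hlift_vscale0 (X : set L) :
  X !=set0 -> hlift (vscale L) [set fzero F] X = [set vzero L].
Proof.
move=> [x0 Xx0]; apply/seteqP; split=> z; rewrite hlift_set1l.
  by case=> x _; rewrite vscale0.
by move=> ->; exists x0; rewrite ?vscale0.
Qed.

Lemma hlift_vscale1 (X : set L) : hlift (vscale L) [set fone F] X = X.
Proof.
apply/seteqP; split=> z; rewrite hlift_set1l.
  by case=> x Xx; rewrite vscale1 => ->.
by move=> Xz; exists z; rewrite ?vscale1.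
Qed.

Lemma bracket_addl x1 x2 y :
  hlift (bracket L) (vadd L x1 x2) [set y] =
  hlift (vadd L) (bracket L x1 y) (bracket L x2 y).
Proof.
have [+ _] := @bracket_bilinear F L (fone F) (fone F) x1 x2 y.
by rewrite !vscale1 !hlift_vscale1 hlift_set11.
Qed.

Lemma bracket_addr y x1 x2 :
  hlift (bracket L) [set y] (vadd L x1 x2) =
  hlift (vadd L) (bracket L y x1) (bracket L y x2).
Proof.
have [_ +] := @bracket_bilinear F L (fone F) (fone F) x1 x2 y.
by rewrite !vscale1 !hlift_vscale1 hlift_set11.
Qed.

(** Bilinearity speaks of combinations of two vectors; a zero second
    coefficient kills one of them. *)
Lemma bracket_scalel a x y :
  hlift (bracket L) (vscale L a x) [set y] =
  hlift (vscale L) [set a] (bracket L x y).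
Proof.
have [+ _] := @bracket_bilinear F L a (fzero F) x x y.
rewrite vscale0 hlift_vadd0r => ->.
by rewrite hlift_vscale0 ?hlift_vadd0r //; apply: bracket_neq0.
Qed.

Lemma bracket_scaler a x y :
  hlift (bracket L) [set y] (vscale L a x) =
  hlift (vscale L) [set a] (bracket L y x).
Proof.
have [_ +] := @bracket_bilinear F L a (fzero F) x x y.
rewrite vscale0 hlift_vadd0r => ->.
by rewrite hlift_vscale0 ?hlift_vadd0r //; apply: bracket_neq0.
Qed.

Lemma beval_bmap (I J : Type) (phi : I -> J) (b : btree I) (g : J -> set L) :
  beval (bmap phi b) g = beval b (g \o phi).
Proof. by elim: b => //= b1 -> b2 ->. Qed.

Lemma eq_in_beval (I : eqType) (b : btree I) (g g' : I -> set L) :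
  {in bleaves b, g =1 g'} -> beval b g = beval b g'.
Proof.
elim: b => [i|b1 IH1 b2 IH2] gg' /=; first by apply: gg'; rewrite inE.
by rewrite IH1 ?IH2 // => i ib; apply: gg'; rewrite mem_cat ib ?orbT.
Qed.

(** A scalar is absorbed by whichever argument one likes, since bilinearity
    lets it go down either branch of each bracket.  Distinct leaves are needed
    for the scaled argument not to occur in the other branch. *)
Lemma beval_scale (I : eqType) (b : btree I) (g g' : I -> set L) j a :
  uniq (bleaves b) -> j \in bleaves b ->
  (forall x, g j x -> vscale L a x `<=` g' j) ->
  (forall i, i != j -> g' i = g i) ->
  forall x, beval b g x -> vscale L a x `<=` beval b g'.
Proof.
move=> + + gj g'E; elim: b => [i|b1 IH1 b2 IH2] /=.
  by rewrite inE => _ /eqP <-; apply: gj.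
rewrite cat_uniq mem_cat => /and3P[u1 /hasPn dis u2] jb.
have other b : j \notin bleaves b -> beval b g' = beval b g.
  move=> jNb; apply: eq_in_beval => i ib; apply: g'E.
  by apply: contraNneq jNb => <-.
move=> x /hliftP[y [z [by1 bz2 yzx]]] w axw.
have : hlift (vscale L) [set a] (bracket L y z) w.
  by apply/hlift_set1l; exists x.
have [jb1|jNb1] := boolP (j \in bleaves b1).
  rewrite -bracket_scalel => /hlift_set1r[v ayv vzw].
  apply/hliftP; exists v, z; split=> //; first exact: (IH1 u1 jb1 y).
  by rewrite other //; apply/negP => /dis; rewrite /= jb1.
rewrite (negbTE jNb1) /= in jb.
rewrite -bracket_scaler => /hlift_set1l[v azv yvw].
apply/hliftP; exists y, v; split=> //; first by rewrite other.
exact: (IH2 u2 jb z).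
Qed.

(** * Permutable sums *)

Record pprod := PProd {
  pp_size : nat;
  pp_fac : 'I_pp_size.+1 -> F;
  pp_perm : 'S_pp_size.+1
}.

Definition pp_left (P : pprod) : set F :=
  hbig (@fmul F) (fun r => [set pp_fac (p := P) r]).
Definition pp_right (P : pprod) : set F :=
  hbig (@fmul F) (fun r => [set pp_fac (pp_perm P r)]).

Record pcoef := PCoef {
  pc_size : nat;
  pc_term : 'I_pc_size.+1 -> pprod;
  pc_perm : 'S_pc_size.+1
}.

Definition pc_left (c : pcoef) : set F :=
  hbig (@fadd F) (fun k => pp_left (pc_term (p := c) k)).
Definition pc_right (c : pcoef) : set F :=
  hbig (@fadd F) (fun k => pp_right (pc_term (pc_perm c k))).

Record parg := PArg { pa_coef : pcoef; pa_vec : L }.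

Definition pa_left (l : parg) : set L :=
  hlift (vscale L) (pc_left (pa_coef l)) [set pa_vec l].
Definition pa_right (l : parg) : set L :=
  hlift (vscale L) (pc_right (pa_coef l)) [set pa_vec l].

(** The derived subset enters only through which arguments may be moved, hence
    an arbitrary [D]. *)
Record pmono (D : set L) := PMono {
  pm_size : nat;
  pm_fun : hbracket_fun pm_size;
  pm_arg : 'I_pm_size -> parg;
  pm_perm : 'S_pm_size;
  pm_fix : forall j, ~ D (pa_vec (pm_arg j)) -> pm_perm j = j
}.

Section Monomials.

Variable D : set L.

Definition pm_left (M : pmono D) : set L :=
  beval (pm_fun M) (fun j => pa_left (pm_arg j)).
Definition pm_right (M : pmono D) : set L :=
  beval (pm_fun M) (fun j => pa_right (pm_arg (pm_perm M j))).

(** [Srel] with its data bundled level by level, so that a whole monomial can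
    be inserted or replaced without transporting its dependent components. *)
Definition psum_rel (x y : L) : Prop :=
  exists (t : nat) (s : 'S_t.+1) (M : 'I_t.+1 -> pmono D),
    hbig (vadd L) (fun i => pm_left (M i)) x /\
    hbig (vadd L) (fun i => pm_right (M (s i))) y.

Definition pp_one : pprod := @PProd 0 (fun _ => fone F) 1%g.
Definition pc_one : pcoef := @PCoef 0 (fun _ => pp_one) 1%g.
Definition pa_one (a : L) : parg := PArg pc_one a.

Lemma pa_left_one a : pa_left (pa_one a) = [set a].
Proof. by rewrite /pa_left hlift_set11 vscale1. Qed.

Lemma pa_right_one a : pa_right (pa_one a) = [set a].
Proof. by rewrite /pa_right hlift_set11 vscale1. Qed.

Definition pm_one (a : L) : pmono D :=
  @PMono D 1 leaf_fun (fun _ => pa_one a) 1%g (fun j _ => perm1 j).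

Lemma pm_left_one a : pm_left (pm_one a) = [set a].
Proof. exact: pa_left_one. Qed.

Lemma pm_right_one a : pm_right (pm_one a) = [set a].
Proof. exact: pa_right_one. Qed.

Lemma psum_rel_refl x : psum_rel x x.
Proof.
by exists 0, 1%g, (fun _ => pm_one x); rewrite /= pm_left_one pm_right_one.
Qed.

(** * Translations of permutable sums *)

Lemma psum_rel_addl a x y u v :
  psum_rel x y -> vadd L a x u -> vadd L a y v -> psum_rel u v.
Proof.
move=> [t [s [M [Mx My]]]] axu ayv.
exists t.+1, (lift_perm ord0 ord0 s), (insert_at ord0 (pm_one a) M).
split; apply/hliftP; [exists a, x|exists a, y]; split=> //.
- by rewrite insert_at_id pm_left_one.
- by under eq_fun do rewrite insert_at_lift.
- by rewrite lift_perm_id insert_at_id pm_right_one.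
- by under eq_fun do rewrite lift_perm_lift insert_at_lift.
Qed.

Lemma psum_rel_addr a x y u v :
  psum_rel x y -> vadd L x a u -> vadd L y a v -> psum_rel u v.
Proof.
move=> [t [s [M [Mx My]]]] xau yav.
exists t.+1, (lift_perm ord_max ord_max s), (insert_at ord_max (pm_one a) M).
rewrite !(hbig_recr vadd_semihypergroup).
split; apply/hliftP; [exists x, a|exists y, a]; split=> //.
- by under eq_fun do rewrite insert_at_lift.
- by rewrite insert_at_id pm_left_one.
- by under eq_fun do rewrite lift_perm_lift insert_at_lift.
- by rewrite lift_perm_id insert_at_id pm_right_one.
Qed.

(** The common pattern of the remaining translations: an additive map [f] acts
    on a sum monomial by monomial, keeping the permutation of the monomials. *)
Lemma psum_rel_additive (f : L -> set L) (phi : pmono D -> pmono D) :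
  (forall x y z, vadd L x y z -> f z `<=` hlift (vadd L) (f x) (f y)) ->
  (forall M x, pm_left M x -> f x `<=` pm_left (phi M)) ->
  (forall M x, pm_right M x -> f x `<=` pm_right (phi M)) ->
  forall x y u v, psum_rel x y -> f x u -> f y v -> psum_rel u v.
Proof.
move=> fD fl fr x y u v [t [s [M [Mx My]]]] fu fv.
exists t, s, (phi \o M); split.
  exact: (hbig_distr fD (fun i => fl (M i)) Mx).
exact: (hbig_distr fD (fun i => fr (M (s i))) My).
Qed.

Definition scale_pprod (a : F) (P : pprod) : pprod :=
  PProd (insert_at ord0 a (@pp_fac P)) (lift_perm ord0 ord0 (pp_perm P)).

Lemma pp_left_scale a P :
  pp_left (scale_pprod a P) = hlift (@fmul F) [set a] (pp_left P).
Proof.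
rewrite /pp_left /= insert_at_id.
by under eq_fun do rewrite insert_at_lift.
Qed.

Lemma pp_right_scale a P :
  pp_right (scale_pprod a P) = hlift (@fmul F) [set a] (pp_right P).
Proof.
rewrite /pp_right /= lift_perm_id insert_at_id.
by under eq_fun do rewrite lift_perm_lift insert_at_lift.
Qed.

Definition scale_pcoef (a : F) (c : pcoef) : pcoef :=
  PCoef (fun k => scale_pprod a (pc_term (p := c) k)) (pc_perm c).

Lemma fmul_addr (a x y z : F) :
  fadd x y z -> fmul a z `<=` hlift (@fadd F) (fmul a x) (fmul a y).
Proof.
have [_ _ /(_ a x y)[<- _]] := fring F.
by move=> xyz w azw; apply/hlift_set1l; exists z.
Qed.

Lemma pc_left_scale a c x :
  pc_left c x -> fmul a x `<=` pc_left (scale_pcoef a c).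
Proof.
apply: (hbig_distr (@fmul_addr a)) => k w Pw z awz.
by rewrite pp_left_scale; apply/hlift_set1l; exists w.
Qed.

Lemma pc_right_scale a c x :
  pc_right c x -> fmul a x `<=` pc_right (scale_pcoef a c).
Proof.
apply: (hbig_distr (@fmul_addr a)) => k w Pw z awz.
by rewrite pp_right_scale; apply/hlift_set1l; exists w.
Qed.

Definition scale_parg (a : F) (l : parg) : parg :=
  PArg (scale_pcoef a (pa_coef l)) (pa_vec l).

Lemma vscale_hlift (X Y : set F) (a : F) (h x : L) :
  (forall b, X b -> fmul a b `<=` Y) ->
  hlift (vscale L) X [set h] x ->
  vscale L a x `<=` hlift (vscale L) Y [set h].
Proof.
move=> XY /hlift_set1r[b Xb bhx] z axz.
have : hlift (vscale L) [set a] (vscale L b h) z by apply/hlift_set1l; exists x.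
rewrite -vscaleA => /hlift_set1r[c abc chz].
by apply/hlift_set1r; exists c => //; apply: XY abc.
Qed.

Lemma pa_left_scale a l x :
  pa_left l x -> vscale L a x `<=` pa_left (scale_parg a l).
Proof. by apply: vscale_hlift => b; apply: pc_left_scale. Qed.

Lemma pa_right_scale a l x :
  pa_right l x -> vscale L a x `<=` pa_right (scale_parg a l).
Proof. by apply: vscale_hlift => b; apply: pc_right_scale. Qed.

Definition scale_pmono (a : F) (M : pmono D) : pmono D.
Proof.
pose j0 := hbracket_arg (pm_fun M).
apply: (@PMono D (pm_size M) (pm_fun M)
  (fun j => if j == j0 then scale_parg a (pm_arg j) else pm_arg j) (pm_perm M)).
by move=> j; case: ifP => _; apply: pm_fix.
Defined.

Lemma pm_left_scale a M x :
  pm_left M x -> vscale L a x `<=` pm_left (scale_pmono a M).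
Proof.
apply: (beval_scale (j := hbracket_arg (pm_fun M))).
- exact: uniq_bleaves.
- exact: mem_bleaves.
- by move=> w; rewrite /= eqxx; apply: pa_left_scale.
- by move=> i /negbTE /= ->.
Qed.

Lemma pm_right_scale a M x :
  pm_right M x -> vscale L a x `<=` pm_right (scale_pmono a M).
Proof.
(* in the permuted reading, the scaled argument occupies this position *)
apply: (beval_scale (j := (pm_perm M)^-1%g (hbracket_arg (pm_fun M)))).
- exact: uniq_bleaves.
- exact: mem_bleaves.
- by move=> w; rewrite /= permKV eqxx; apply: pa_right_scale.
- move=> i ij; rewrite /= ifN //; apply: contraNneq ij => <-.
  by rewrite permK.
Qed.

Lemma psum_rel_scale a x y u v :
  psum_rel x y -> vscale L a x u -> vscale L a y v -> psum_rel u v.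
Proof.
apply: psum_rel_additive (@pm_left_scale a) (@pm_right_scale a) x y u v.
move=> x y z xyz w azw; rewrite -vscaleDr.
by apply/hlift_set1l; exists z.
Qed.

Lemma insert_arg_fix a (M : pmono D) j :
  ~ D (pa_vec (insert_at ord0 (pa_one a) (@pm_arg D M) j)) ->
  lift_perm ord0 ord0 (pm_perm M) j = j.
Proof.
case: (unliftP ord0 j) => [i ->|->]; last by rewrite lift_perm_id.
by rewrite insert_at_lift lift_perm_lift => /pm_fix ->.
Qed.

Definition bracketl_pmono (a : L) (M : pmono D) : pmono D :=
  PMono (bracketl_fun (pm_fun M)) (@insert_arg_fix a M).

Definition bracketr_pmono (a : L) (M : pmono D) : pmono D :=
  PMono (bracketr_fun (pm_fun M)) (@insert_arg_fix a M).

Lemma beval_insert_left a (M : pmono D) :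
  beval (bmap (lift ord0) (pm_fun M))
    (fun j => pa_left (insert_at ord0 (pa_one a) (@pm_arg D M) j)) = pm_left M.
Proof.
rewrite beval_bmap; congr beval; apply/funext=> j /=.
by rewrite insert_at_lift.
Qed.

Lemma beval_insert_right a (M : pmono D) :
  beval (bmap (lift ord0) (pm_fun M))
    (fun j => pa_right (insert_at ord0 (pa_one a) (@pm_arg D M)
                          (lift_perm ord0 ord0 (pm_perm M) j))) = pm_right M.
Proof.
rewrite beval_bmap; congr beval; apply/funext=> j /=.
by rewrite lift_perm_lift insert_at_lift.
Qed.

Lemma psum_rel_bracketl a x y u v :
  psum_rel x y -> bracket L a x u -> bracket L a y v -> psum_rel u v.
Proof.
apply: (@psum_rel_additive (bracket L a) (bracketl_pmono a)).
- move=> {}x {}y z xyz w azw; rewrite -bracket_addr.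
  by apply/hlift_set1l; exists z.
- move=> M {}x Mx w axw; apply/hliftP; exists a, x; split=> //.
    by rewrite /= insert_at_id pa_left_one.
  by rewrite -(beval_insert_left a) in Mx.
- move=> M {}x Mx w axw; apply/hliftP; exists a, x; split=> //.
    by rewrite /= lift_perm_id insert_at_id pa_right_one.
  by rewrite -(beval_insert_right a) in Mx.
Qed.

Lemma psum_rel_bracketr a x y u v :
  psum_rel x y -> bracket L x a u -> bracket L y a v -> psum_rel u v.
Proof.
apply: (@psum_rel_additive ((bracket L)^~ a) (bracketr_pmono a)).
- move=> {}x {}y z xyz w azw; rewrite -bracket_addl.
  by apply/hlift_set1r; exists z.
- move=> M {}x Mx w axw; apply/hliftP; exists x, a; split=> //.
    by rewrite -(beval_insert_left a) in Mx.
  by rewrite /= insert_at_id pa_left_one.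
- move=> M {}x Mx w axw; apply/hliftP; exists x, a; split=> //.
    by rewrite -(beval_insert_right a) in Mx.
  by rewrite /= lift_perm_id insert_at_id pa_right_one.
Qed.

(** * Reversal of permutable sums *)

Definition rev_pprod (P : pprod) : pprod :=
  PProd (fun r => pp_fac (pp_perm P r)) (pp_perm P)^-1%g.

Lemma pp_right_rev P : pp_right (rev_pprod P) = pp_left P.
Proof. by rewrite /pp_right /=; under eq_fun do rewrite permKV. Qed.

Definition rev_pcoef (c : pcoef) : pcoef :=
  PCoef (fun k => rev_pprod (pc_term (pc_perm c k))) (pc_perm c)^-1%g.

Lemma pc_right_rev c : pc_right (rev_pcoef c) = pc_left c.
Proof.
by rewrite /pc_right /=; under eq_fun do rewrite permKV pp_right_rev.
Qed.

Definition rev_parg (l : parg) : parg :=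
  PArg (rev_pcoef (pa_coef l)) (pa_vec l).

Lemma pa_right_rev l : pa_right (rev_parg l) = pa_left l.
Proof. by rewrite /pa_right pc_right_rev. Qed.

Definition rev_pmono (M : pmono D) : pmono D.
Proof.
apply: (@PMono D (pm_size M) (pm_fun M)
  (fun j => rev_parg (pm_arg (pm_perm M j))) (pm_perm M)^-1%g).
(* a fixed image is a fixed point *)
by move=> j /= /pm_fix /perm_inj sj; rewrite -{1}sj permK.
Defined.

Lemma pm_right_rev M : pm_right (rev_pmono M) = pm_left M.
Proof.
by rewrite /pm_right /=; under eq_fun do rewrite permKV pa_right_rev.
Qed.

Lemma psum_rel_sym x y : psum_rel x y -> psum_rel y x.
Proof.
move=> [t [s [M [Mx My]]]].
exists t, s^-1%g, (fun i => rev_pmono (M (s i))); split=> //.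
by under eq_fun do rewrite permKV pm_right_rev.
Qed.

End Monomials.

(** * Transitive closure *)

Lemma SrelE n (x y : L) : Srel n x y <-> psum_rel (@Lder F L n.-1) x y.
Proof.
split=> [[t [s [m [f [h [s1 [p [s2 [q [lam [s3 [fix1 Sx Sy]]]]]]]]]]]]|].
  exists t, s, (fun i => PMono (f i) (pm_arg := fun j =>
    PArg (PCoef (fun k => PProd (lam i j k) (s3 i j k)) (s2 i j)) (h i j))
    (fix1 i)).
  by [].
move=> [t [s [M [Mx My]]]].
exists t, s, (fun i => pm_size (M i)), (fun i => pm_fun (M i)).
exists (fun i j => pa_vec (pm_arg (p := M i) j)), (fun i => pm_perm (M i)).
exists (fun i j => pc_size (pa_coef (pm_arg (p := M i) j))).
exists (fun i j => pc_perm (pa_coef (pm_arg (p := M i) j))).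
exists (fun i j k => pp_size (pc_term (p := pa_coef (pm_arg (p := M i) j)) k)).
exists (fun i j k =>
  pp_fac (p := pc_term (p := pa_coef (pm_arg (p := M i) j)) k)).
exists (fun i j k =>
  pp_perm (pc_term (p := pa_coef (pm_arg (p := M i) j)) k)).
by split=> // i j; apply: pm_fix.
Qed.

(** Along a chain the translates of the intermediate points must be met, hence
    the hypothesis that [f] has non-empty values. *)
Lemma setrel_clos_trans (rho : L -> L -> Prop) (f : L -> set L) :
  (forall x, f x !=set0) ->
  (forall x y u v, rho x y -> f x u -> f y v -> rho u v) ->
  forall x y, clos_trans L rho x y -> setrel (clos_trans L rho) (f x) (f y).
Proof.
move=> f0 frho x y; elim=> {x y} [x y xy|x y z _ IHxy _ IHyz] u v fu fv.
  by apply: t_step; apply: frho xy fu fv.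
by have [w fw] := f0 y; apply: t_trans (IHxy _ _ fu fw) (IHyz _ _ fw fv).
Qed.

Lemma equivalence_clos_trans (T : Type) (rho : T -> T -> Prop) :
  (forall x, rho x x) -> (forall x y, rho x y -> rho y x) ->
  equivalence T (clos_trans T rho).
Proof.
move=> rho_refl rho_sym; split.
- by move=> x; apply: t_step.
- by move=> x y z; apply: t_trans.
- move=> x y; elim=> {x y} [x y /rho_sym|x y z _ yx _ zy]; first exact: t_step.
  exact: t_trans zy yx.
Qed.

End Translations.

Theorem proposition3p2 (F : hyperField) (L : lieHyperalgebra F) (n : nat)
    (hn : (1 <= n)%N) :
  @strongly_regular F L (clos_trans L (@Srel F L n)).
Proof.
have -> : @Srel F L n = psum_rel (@Lder F L n.-1).
  by apply/funext=> x; apply/funext=> y; apply/propext; apply: SrelE.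
split.
  exact: equivalence_clos_trans (@psum_rel_refl F L _) (@psum_rel_sym F L _).
move=> x y xy a lambda; split.
- by apply: setrel_clos_trans xy => [z|*];
    [apply: vadd_neq0|apply: psum_rel_addl; eassumption].
- by apply: (setrel_clos_trans (f := (vadd L)^~ a)) xy => [z|*];
    [apply: vadd_neq0|apply: psum_rel_addr; eassumption].
- by apply: setrel_clos_trans xy => [z|*];
    [apply: vscale_neq0|apply: psum_rel_scale; eassumption].
- by apply: setrel_clos_trans xy => [z|*];
    [apply: bracket_neq0|apply: psum_rel_bracketl; eassumption].
- by apply: (setrel_clos_trans (f := (bracket L)^~ a)) xy => [z|*];
    [apply: bracket_neq0|apply: psum_rel_bracketr; eassumption].
Qed.
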